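(* Let $f(x_1,x_2)\in\mathbb{R}[x_1,x_2]$ be a bivariate polynomial of degree $d$ with $f(0,0)=1$ such that all roots of $f_{x_1}=f(x_1,0)$ are real, and let $D_1=\mathrm{Diag}(r_1,\dots,r_d)$ be the real diagonal matrix (unique up to ordering of its entries) with $f(x_1,0)=\det(I+x_1D_1)$. Then $f$ is determinantal, i.e. $f(x_1,x_2)=\det(I+x_1D_1+x_2A_{12})$ for some real symmetric $d\times d$ matrix $A_{12}$, if and only if, for some real solution $\mathbf{y}$ of the linear system $G\mathbf{y}=\mathbf{z}$ that determines the diagonal of $A_{12}$, the real variety $\mathcal{V}_{\mathbb{R}}(\mathcal{I})$ is non-empty. Here $\mathcal{I}=\mathcal{I}(\mathbf{y})$ is the ideal generated by the $\binom{d}{2}$ polynomials with real coefficients, in the $\binom{d}{2}$ unknown off-diagonal entries of $A_{12}$, obtained from the coefficients of the monomials $x_1^{\alpha_1}x_2^{\alpha_2}$ with $0\le\alpha_1\le d-2$, $2\le\alpha_2\le d$, $\alpha_1+\alpha_2\le d$.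
   Context: The matrix $G$ is the $d\times d$ matrix whose $(k+1,j)$ entry ($0\le k\le d-1$, $1\le j\le d$) is the $k$-th elementary symmetric function of the $d-1$ numbers $r_1,\dots,r_{j-1},r_{j+1},\dots,r_d$ (so the first row is all ones), and $\mathbf{z}\in\mathbb{R}^d$ is the column vector whose $(k+1)$-st entry is the coefficient of $x_1^{k}x_2$ in $f$, $0\le k\le d-1$. The equations $G\mathbf{y}=\mathbf{z}$ express that the coefficients of $x_1^kx_2$ in $f$ and in $\det(I+x_1D_1+x_2A_{12})$ agree when $\mathbf{y}$ is the vector of diagonal entries of $A_{12}$; the solution is unique when $r_1,\dots,r_d$ are distinct. Given $D_1$ and a real solution $\mathbf{y}$, let $A_{12}$ be the symmetric $d\times d$ matrix with diagonal $\mathbf{y}$ and with the $\binom d2$ entries above the diagonal taken as indeterminates. For each monomial $x_1^{\alpha_1}x_2^{\alpha_2}$ in the stated range, the associated generator of $\mathcal{I}$ is the polynomial (in these indeterminates) $$\widehat{D}(\underbrace{D_1,\dots,D_1}_{\alpha_1},\underbrace{A_{12},\dots,A_{12}}_{\alpha_2})-f_{\alpha_1\alpha_2},$$ where $f_{\alpha_1\alpha_2}$ is the coefficient of $x_1^{\alpha_1}x_2^{\alpha_2}$ in $f$ and $\widehat{D}(\underbrace{D_1,\dots,D_1}_{\alpha_1},\underbrace{A_{12},\dots,A_{12}}_{\alpha_2})$ (the generalized mixed discriminant) is, with $k=\alpha_1+\alpha_2$, the sum over all $k$-element subsets $S\subseteq\{1,\dots,d\}$ and over all ways to choose $\alpha_1$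 of the indices in $S$, of the determinant of the $k\times k$ matrix with columns indexed by $S$ whose rows with chosen indices are taken from $D_1$ and whose remaining $\alpha_2$ rows are taken from $A_{12}$; equivalently, it is the coefficient of $x_1^{\alpha_1}x_2^{\alpha_2}$ in $\det(I+x_1D_1+x_2A_{12})$. $\mathcal{V}_{\mathbb{R}}(\mathcal{I})$ denotes the set of common real zeros of $\mathcal{I}$ in $\mathbb{R}^{\binom d2}$. *)

(* Defs.v *)
From HB Require Import structures.
From mathcomp Require Import all_boot all_order all_algebra.
From mathcomp Require Import complex reals mpoly.

Set Implicit Arguments.
Unset Strict Implicit.
Unset Printing Implicit Defensive.

Import Order.TTheory GRing.Theory Num.Theory.
Local Open Scope ring_scope.

Section Bivariate.
Variable R : realType.

Definition x1 : {mpoly R[2]} := 'X_(0 : 'I_2).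
Definition x2 : {mpoly R[2]} := 'X_(1 : 'I_2).

Definition mnm2 (a1 a2 : nat) : 'X_{1..2} := [multinom [tuple a1; a2]].

Definition restr_x1 (f : {mpoly R[2]}) : {poly R} :=
  mmap (@polyC R) (fun i : 'I_2 => if i == 0 then 'X else 0) f.

Definition all_roots_real (p : {poly R}) : Prop :=
  forall z : R[i], root (map_poly (@real_complex R) p) z -> complex.Im z = 0.

Definition det_pencil1 d (D : 'M[R]_d) : {poly R} :=
  \det (1%:M + 'X *: map_mx (@polyC R) D).

Definition det_pencil2 d (D A : 'M[R]_d) : {mpoly R[2]} :=
  \det (1%:M + x1 *: map_mx (@mpolyC 2 R) D + x2 *: map_mx (@mpolyC 2 R) A).

Definition determinantal d (D : 'M[R]_d) (f : {mpoly R[2]}) : Prop :=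
  exists A : 'M[R]_d, A^T = A /\ f = det_pencil2 D A.

(* [lift j] enumerates the indices different from [j]. *)
Definition Gmx d (r : 'rV[R]_d) : 'M[R]_d :=
  \matrix_(k, j) (mesym d.-1 R k).@[fun i => r 0 (lift j i)].

Definition zvec d (f : {mpoly R[2]}) : 'cV[R]_d :=
  \col_k f@_(mnm2 k 1).

End Bivariate.

(* The generalized mixed discriminant with [a1] copies of [D] and [a2] copies
   of [A]: [T] is the set of those indices in [S] whose rows come from [D]. *)
Definition mixed_discriminant (K : comNzRingType) d (a1 a2 : nat)
    (D A : 'M[K]_d) : K :=
  \sum_(S : {set 'I_d} | #|S| == (a1 + a2)%N)
    \sum_(T : {set 'I_d} | (T \subset S) && (#|T| == a1))
      \det (\matrix_(i < #|S|, j < #|S|)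
              (if enum_val i \in T then D else A) (enum_val i) (enum_val j)).

Section GeneratedIdeal.
Variables (R : realType) (n : nat) (I : finType) (g : I -> {mpoly R[n]}).

Definition ideal_generated : {mpoly R[n]} -> Prop :=
  fun p => exists c : I -> {mpoly R[n]}, p = \sum_i c i * g i.

End GeneratedIdeal.

Definition real_variety (R : realType) n (J : {mpoly R[n]} -> Prop) :
    ('I_n -> R) -> Prop :=
  fun v => forall p, J p -> p.@[v] = 0.

Definition upper (d : nat) := {p : 'I_d * 'I_d | (p.1 < p.2)%N}.

Definition monomial_range (d : nat) :=
  {a : 'I_d.+1 * 'I_d.+1 |
    [&& (a.1 <= d - 2)%N, (2 <= a.2 <= d)%N & (a.1 + a.2 <= d)%N]}.

Lemma card_upper d : #|{: upper d}| = 'C(d, 2).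
Proof.
rewrite card_sig -sum1_card -bin2_sum big_mkord.
rewrite (eq_bigl (fun p : 'I_d * 'I_d => true && (p.1 < p.2)%N)) //.
rewrite -(pair_big_dep (fun _ => true) (fun i j : 'I_d => (i < j)%N)
            (fun _ _ => 1%N)) /=.
rewrite (exchange_big_dep predT) //=; apply: eq_bigr => j _.
rewrite (eq_bigl (fun i : 'I_d => (i < j)%N)) //.
rewrite -(big_ord_widen d (fun _ => 1%N)) ?(ltnW (ltn_ord j)) //.
by rewrite sum1_card card_ord.
Qed.

Section VarietyData.
Variables (R : realType) (d : nat).

Let P := {mpoly R[#|{: upper d}|]}.

(* [insub] returns the index of the unknown in position (min(i,j), max(i,j))
   when i != j, and [None] exactly when i = j. *)
Definition symbolic_sym (y : 'cV[R]_d) : 'M[P]_d :=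
  \matrix_(i, j)
    if insub (if (i < j)%N then (i, j) else (j, i)) is Some p
    then 'X_(enum_rank (p : upper d))
    else (y i 0)%:MP.

Definition generator (f : {mpoly R[2]}) (r : 'rV[R]_d) (y : 'cV[R]_d)
    (a : monomial_range d) : P :=
  mixed_discriminant (val a).1 (val a).2
    (map_mx (@mpolyC _ R) (diag_mx r)) (symbolic_sym y)
  - (f@_(mnm2 (val a).1 (val a).2))%:MP.

Definition idealI (f : {mpoly R[2]}) (r : 'rV[R]_d) (y : 'cV[R]_d) : P -> Prop :=
  ideal_generated (generator f r y).

End VarietyData.

(* Main.v *)
Require Import Defs.
From mathcomp Require Import all_boot all_order all_algebra.
From mathcomp Require Import fingroup perm.
From mathcomp Require Import complex reals mpoly.
Local Open Scope ring_scope.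
Import GRing.Theory.

Set Implicit Arguments.
Unset Strict Implicit.
Unset Printing Implicit Defensive.

(** The theorem compares coefficients. Expanding [det (I + x1 D + x2 A)] by
    multilinearity in the rows, each row being taken from [I], from [x1 D] or
    from [x2 A], shows that its coefficient at [x1^a x2^b] is the mixed
    discriminant of [a] copies of [D] and [b] copies of [A]
    ([mcoeff_det_pencil2]): the rows taken from [I] reduce each determinant to
    a principal minor. Hence [f = det (I + x1 D1 + x2 A)] holds exactly when
    every coefficient of [f] is the corresponding mixed discriminant, and these
    equations split according to the exponent [b] of [x2]:

    - [b = 0]: both sides restrict to [det (I + x1 D1)] on the line [x2 = 0],
      so these equations hold for every [A] ([restr_x1_det_pencil2]);
    - [b = 1]: as [D1] is diagonal, only the diagonal of [A] matters, and the
      equations are the linear system [G y = z], where [y] is this diagonal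
      ([Gmx_mul_diag]);
    - [b >= 2] and [a + b <= d]: these are the generators of the ideal,
      evaluated at the off-diagonal entries of [A], because mixed discriminants
      commute with ring morphisms ([meval_generator]);
    - [a + b > d]: both coefficients vanish, as [f] has degree [d] and a
      [d]-by-[d] matrix has no principal minor of larger size.

    Finally, symmetric matrices with diagonal [y] are the same thing as real
    values of the unknowns in [symbolic_sym y], and a point is a zero of an
    ideal as soon as it is a zero of its generators. *)

(** * Determinants and principal minors *)

(** Such an [h] permutes the indices, so rows and columns contribute the same
    sign. Keeping [m] and [d] distinct lets [h] come from an index type that is
    a sum, which gives access to block matrices. *)
Lemma det_mxsub_inj (K : comNzRingType) m d (h : 'I_m -> 'I_d) (M : 'M[K]_d) :
  m = d -> injective h -> \det (mxsub h h M) = \det M.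
Proof.
move=> e; move: h; rewrite e => h inj_h.
have -> : mxsub h h M = row_perm (perm inj_h) (col_perm (perm inj_h) M).
  by apply/matrixP=> i j; rewrite !mxE !permE.
rewrite row_permE col_permE !det_mulmx !det_perm mulrCA -signr_addb.
by rewrite odd_permV addbb mulr1.
Qed.

(** Listing the indices of [S] before the others makes the matrix block upper
    triangular, with an identity block in the lower right corner. *)
Lemma det_principal_minor (K : comNzRingType) d (S : {set 'I_d}) (M : 'M[K]_d) :
  \det (\matrix_(i, j) (if i \in S then M else 1%:M) i j) =
  \det (\matrix_(i < #|S|, j < #|S|) M (enum_val i) (enum_val j)).
Proof.
pose h (k : 'I_(#|S| + #|~: S|)) :=
  match split k with inl i => enum_val i | inr j => enum_val j end.
have inS (i : 'I_#|S|) : enum_val i \in S by exact: enum_valP.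
have ninS (i : 'I_#|~: S|) : enum_val i \notin S.
  by have := enum_valP i; rewrite inE.
have inj_h : injective h.
  move=> k l; rewrite -[k]splitK -[l]splitK /h !unsplitK.
  case: (split k) => i; case: (split l) => j //= e.
  - by rewrite (enum_val_inj e).
  - by have := ninS j; rewrite -e inS.
  - by have := ninS i; rewrite e inS.
  - by rewrite (enum_val_inj e).
rewrite -(det_mxsub_inj _ _ inj_h); last by rewrite cardsC card_ord.
set N := mxsub _ _ _; rewrite -[N]submxK.
have -> : dlsubmx N = 0.
  apply/matrixP=> i j; rewrite !mxE /h (unsplitK (inl _)) (unsplitK (inr _)).
  rewrite (negPf (ninS i)) mxE; case: eqP => // e.
  by have := ninS i; rewrite e inS.
have -> : drsubmx N = 1%:M.
  apply/matrixP=> i j; rewrite !mxE /h !(unsplitK (inr _)).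
  by rewrite (negPf (ninS i)) mxE (inj_eq enum_val_inj).
rewrite det_ublock det1 mulr1; congr (\det _).
by apply/matrixP=> i j; rewrite !mxE /h !(unsplitK (inl _)) inS.
Qed.

Lemma det_add_rows (K : comNzRingType) d (A B : 'M[K]_d) :
  \det (A + B) =
  \sum_(T : {set 'I_d}) \det (\matrix_(i, j) (if i \in T then A else B) i j).
Proof.
rewrite exchange_big /=; apply: eq_bigr => s _; rewrite -mulr_sumr.
under eq_bigr do rewrite mxE.
rewrite bigA_distr; congr (_ * _).
by apply: eq_bigr => T _; apply: eq_bigr => i _; rewrite mxE; case: ifP.
Qed.

Lemma det_scale_rows (K : comNzRingType) d (c : 'I_d -> K) (M : 'M[K]_d) :
  \det (\matrix_(i, j) (c i * M i j)) = (\prod_i c i) * \det M.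
Proof.
have -> : \matrix_(i, j) (c i * M i j) = diag_mx (\row_i c i) *m M.
  by apply/matrixP=> i j; rewrite mul_diag_mx !mxE.
by rewrite det_mulmx det_diag; under eq_bigr do rewrite mxE.
Qed.

(** A permutation other than the identity moves at least two indices, hence one
    that differs from [j], and the corresponding entry is zero. *)
Lemma det_diag_off_row (K : comNzRingType) d (j : 'I_d) (M : 'M[K]_d) :
  (forall i k, i != j -> k != i -> M i k = 0) -> \det M = \prod_i M i i.
Proof.
move=> M0; rewrite /determinant (bigD1 (1%g : 'S_d)) //= odd_perm1 mul1r.
rewrite [X in _ + X]big1 ?addr0 => [|s s1].
  by apply: eq_bigr => i _; rewrite perm1.
have [i ij si] : exists2 i, i != j & s i != i.
  (* If [s] moves [j], injectivity shows that it also moves [s j]. *)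
  case: (eqVneq (s j) j) => [sj|sj]; last first.
    by exists (s j) => //; rewrite (inj_eq perm_inj).
  have [i si] : exists i, s i != i.
    apply/existsP; apply: contraR s1; rewrite negb_exists => /forallP s1.
    by apply/eqP/permP=> i; rewrite perm1; apply/eqP; rewrite -[_ == _]negbK.
  by exists i => //; apply: contraNneq si => ->; rewrite sj.
by rewrite (bigD1 i) //= M0 // mul0r mulr0.
Qed.

(** * Coefficients of the determinantal pencil *)

Section Pencil.
Variables (K : comNzRingType) (d : nat) (s t : K) (D A : 'M[K]_d).

(** [S] collects the rows that are not taken from the identity and [T] those
    that are taken from [s *: D]. *)
Lemma det_pencil_expand :
  \det (1%:M + s *: D + t *: A) =
  \sum_(S : {set 'I_d}) \sum_(T : {set 'I_d} | T \subset S)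
    s ^+ #|T| * t ^+ (#|S| - #|T|) *
    \det (\matrix_(i < #|S|, j < #|S|)
            (if enum_val i \in T then D else A) (enum_val i) (enum_val j)).
Proof.
rewrite -addrA addrC det_add_rows; apply: eq_bigr => S _.
have -> : \matrix_(i, j) (if i \in S then s *: D + t *: A else 1%:M) i j =
   (\matrix_(i, j) (if i \in S then s * D i j else 0)) +
   (\matrix_(i, j) (if i \in S then t * A i j else (i == j)%:R)).
  by apply/matrixP=> i j; rewrite !mxE; case: ifP; rewrite !mxE // add0r.
(* A set [T] that leaves [S] selects a zero row and contributes nothing. *)
rewrite det_add_rows [RHS]big_mkcond /=; apply: eq_bigr => T _.
case: ifPn => [/subsetP sTS|/subsetPn [i iT iS]]; last first.
  rewrite (expand_det_row _ i) big1 // => k _.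
  by rewrite !mxE iT mxE (negPf iS) mul0r.
pose c i := if i \in T then s else if i \in S then t else 1.
pose N := \matrix_(i, j) (if i \in S then \matrix_(i, j)
   (if i \in T then D else A) i j else 1%:M) i j.
transitivity (\det (\matrix_(i, j) (c i * N i j))).
  congr (\det _); apply/matrixP=> i j; rewrite !mxE /c.
  case: ifPn => iT; first by rewrite !mxE sTS // mxE iT.
  by rewrite !mxE; case: ifP => iS; rewrite !mxE ?(negPf iT) // mul1r.
rewrite det_scale_rows det_principal_minor. congr (_ * _); last first.
  by congr (\det _); apply/matrixP=> i j; rewrite !mxE.
rewrite (bigID (mem T)) /=; congr (_ * _).
  by rewrite (eq_bigr (fun=> s)) ?prodr_const // => i; rewrite /c => ->.
rewrite -cardsDS; last exact/subsetP.
rewrite -prodr_const big_mkcond [RHS]big_mkcond; apply: eq_bigr => i _.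
by rewrite inE /c; case: (i \in T).
Qed.

End Pencil.

Lemma map_mixed_discriminant (K L : comNzRingType) (g : {rmorphism K -> L})
    d a b (D A : 'M[K]_d) :
  mixed_discriminant a b (map_mx g D) (map_mx g A) =
  g (mixed_discriminant a b D A).
Proof.
rewrite /mixed_discriminant rmorph_sum; apply: eq_bigr => S _.
rewrite rmorph_sum; apply: eq_bigr => T _; rewrite -det_map_mx.
by congr (\det _); apply/matrixP=> i j; rewrite !mxE; case: ifP; rewrite mxE.
Qed.

Section Coefficients.
Variable R : realType.

Lemma x12E a b : x1 R ^+ a * x2 R ^+ b = 'X_[mnm2 a b].
Proof.
rewrite /x1 /x2 !mpolyXn -mpolyXD; congr 'X_[_]; apply/mnmP=> i.
rewrite mnmDE !mulmnE !mnm1E; case: i => [[|[|//]] i] /=.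
  by rewrite mnm_tnth /= addn0 mul1n.
by rewrite mnm_tnth /= add0n mul1n.
Qed.

Lemma mnm2_eq (m : 'X_{1..2}) a b : (m == mnm2 a b) = (m 0 == a) && (m 1 == b).
Proof.
apply/eqP/andP => [->|[/eqP e0 /eqP e1]]; first by rewrite !mnm_tnth.
apply/mnmP=> i; case: i => [[|[|//]] i].
  by rewrite (_ : Ordinal i = 0) ?e0 ?mnm_tnth //; apply: val_inj.
by rewrite (_ : Ordinal i = 1) ?e1 ?mnm_tnth //; apply: val_inj.
Qed.

Lemma mcoeff_det_pencil2 d a b (D A : 'M[R]_d) :
  (det_pencil2 D A)@_(mnm2 a b) = mixed_discriminant a b D A.
Proof.
rewrite /det_pencil2 det_pencil_expand raddf_sum /=.
rewrite /mixed_discriminant [RHS]big_mkcond; apply: eq_bigr => S _ /=.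
rewrite raddf_sum.
pose c (T : {set 'I_d}) := \det (\matrix_(i < #|S|, j < #|S|)
  (if enum_val i \in T then D else A) (enum_val i) (enum_val j)).
transitivity (\sum_(T : {set 'I_d} | T \subset S)
   if (#|S| == a + b)%N && (#|T| == a) then c T else 0); last first.
  case: (_ == _) => /=; last by rewrite big1.
  by rewrite big_mkcondr.
apply: eq_bigr => T sTS; rewrite /= x12E.
set M := \matrix_(_, _) _.
have -> : M = map_mx (@mpolyC 2 R) (\matrix_(i < #|S|, j < #|S|)
  (if enum_val i \in T then D else A) (enum_val i) (enum_val j)).
  by apply/matrixP=> i j; rewrite !mxE; case: ifP; rewrite mxE.
rewrite det_map_mx -/(c T) mulrC mcoeffCM mcoeffX mnm2_eq !mnm_tnth /=.
rewrite -[in RHS](subnKC (subset_leq_card sTS)).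
case: (eqVneq #|T| a) => [->|_]; last by rewrite andbF mulr0.
by rewrite eqn_add2l andbT; case: eqP; rewrite ?mulr1 ?mulr0.
Qed.

Lemma coef_restr_x1 (f : {mpoly R[2]}) k : (restr_x1 f)`_k = f@_(mnm2 k 0).
Proof.
rewrite {2}[f]mpolyE raddf_sum /restr_x1 /mmap coef_sum.
apply: eq_bigr => m _ /=; rewrite mcoeffZ mcoeffX mnm2_eq coefCM.
rewrite /mmap1 big_ord_recl big_ord1 /= (_ : lift _ _ = 1); last exact: val_inj.
rewrite expr0n; case: (m 1 == 0%N); last by rewrite mulr0 coef0 andbF.
by rewrite mulr1 coefXn andbT eq_sym.
Qed.

Lemma restr_x1_det_pencil2 d (D A : 'M[R]_d) :
  restr_x1 (det_pencil2 D A) = det_pencil1 D.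
Proof.
rewrite /restr_x1 /det_pencil2 -det_map_mx; congr (\det _).
apply/matrixP=> i j; rewrite !mxE !rmorphD !rmorphM /= !mmapC !mmapX.
rewrite !mmap1U /= mul0r addr0; congr (_ + _).
by rewrite rmorph_nat.
Qed.
End Coefficients.

(** * The coefficients of degree one in the second variable *)

Section Linear.
Variables (K : comNzRingType) (d : nat) (r : 'rV[K]_d) (A : 'M[K]_d).

Lemma det_one_row_off_diag (T : {set 'I_d}) j : j \notin T ->
  \det (\matrix_(i < #|j |: T|, k < #|j |: T|)
     (if enum_val i \in T then diag_mx r else A) (enum_val i) (enum_val k)) =
  (\prod_(i in T) r 0 i) * A j j.
Proof.
move=> jT.
pose N := \matrix_(i, k) (if i \in T then diag_mx r else A) i k.
transitivity (\det (\matrix_(i < #|j |: T|, k < #|j |: T|)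
    N (enum_val i) (enum_val k))).
  by congr (\det _); apply/matrixP=> i k; rewrite !mxE.
rewrite -det_principal_minor (@det_diag_off_row _ _ j) => [|i k ij ki].
  transitivity (\prod_(i in j |: T) N i i).
    rewrite [RHS]big_mkcond; apply: eq_bigr => i _; rewrite mxE.
    by case: ifP => // _; rewrite mxE eqxx.
  rewrite big_setU1 //= mulrC !mxE (negPf jT); congr (_ * _).
  by apply: eq_bigr => i iT; rewrite !mxE iT mxE eqxx.
rewrite mxE; case: ifP => [|_]; rewrite !mxE.
  by rewrite !inE (negPf ij) /= => ->; rewrite mxE eq_sym (negPf ki).
by rewrite eq_sym (negPf ki).
Qed.

(** With one row from [A], the index sets satisfy [S = j |: T], where [j] is the
    index of that row; all the other rows are diagonal, so [A] contributes only
    through [A j j]. *)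
Lemma mixed_discriminant_linear k :
  mixed_discriminant k 1 (diag_mx r) A =
  \sum_j (\sum_(T : {set 'I_d} | (j \notin T) && (#|T| == k))
            \prod_(i in T) r 0 i) * A j j.
Proof.
rewrite /mixed_discriminant.
rewrite (exchange_big_dep (fun T : {set 'I_d} => #|T| == k)) /=; last first.
  by move=> S T _ /andP[].
transitivity (\sum_(T : {set 'I_d} | #|T| == k) \sum_(j in ~: T)
    (\prod_(i in T) r 0 i) * A j j).
  apply: eq_bigr => T /eqP cT.
  have inj : {in ~: T &, injective (fun j => j |: T)}.
    move=> i j; rewrite !inE => iT jT /setP /(_ i).
    by rewrite !inE eqxx (negPf iT) !orbF => /esym/eqP.
  have notT j : j \in ~: T -> j \notin T by rewrite inE.
  under [RHS]eq_bigr => j jT do rewrite -(det_one_row_off_diag (notT j jT)).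
  rewrite /= -(big_imset (fun S : {set 'I_d} => \det (\matrix_(i < #|S|, j < #|S|)
    (if enum_val i \in T then diag_mx r else A) (enum_val i) (enum_val j))) inj).
  apply: eq_bigl => S; rewrite cT eqxx andbT.
  apply/andP/imsetP => [[/eqP cS sTS]|[j]].
    have /cards1P [j Sj] : #|S :\: T| == 1%N by rewrite cardsDS // cS cT addKn.
    exists j; first by have: j \in S :\: T; [rewrite Sj set11 | rewrite !inE => /andP[]].
    by rewrite -Sj setUC -[LHS](setID S T) (setIidPr sTS).
  by rewrite inE => jT ->; rewrite cardsU1 jT cT add1n addn1 eqxx subsetUr.
rewrite (exchange_big_dep xpredT) //=; apply: eq_bigr => j _.
by rewrite mulr_suml; apply: eq_bigl => T; rewrite inE andbC.
Qed.

End Linear.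

(** The sets that avoid [j] are the images under [lift j] of the sets of
    indices of the remaining variables. *)
Lemma meval_mesym_lift (R : realType) d (r : 'rV[R]_d) (j : 'I_d) k :
  (mesym d.-1 R k).@[fun i => r 0 (lift j i)] =
  \sum_(T : {set 'I_d} | (j \notin T) && (#|T| == k)) \prod_(i in T) r 0 i.
Proof.
rewrite /mesym raddf_sum /=.
under eq_bigr => h _ do rewrite rmorph_prod /=.
rewrite (reindex_onto (fun h : {set 'I_d.-1} => lift j @: h)
  (fun T : {set 'I_d} => lift j @^-1: T)) /=; last first.
  move=> T /andP[jT _]; apply/setP=> i; apply/imsetP/idP => [[l]|iT].
    by rewrite inE => lT ->.
  have [l e _] : exists2 l, i = lift j l & true.
    by case: (unliftP j i) => [l|] e; [exists l | rewrite -e iT in jT].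
  by exists l; rewrite // inE -e.
have inj := @lift_inj _ j.
apply: eq_big => [h|h _].
  rewrite card_imset //; suff -> : j \notin lift j @: h.
    rewrite andTb; apply/idP/andP => [->|[]//]; split=> //.
    by apply/eqP/setP=> i; rewrite inE (mem_imset _ _ inj).
  by apply/imsetP=> -[i _] /eqP; rewrite (negPf (neq_lift _ _)).
rewrite big_imset /=; last by move=> x y _ _; apply: inj.
by apply: eq_bigr => i _; rewrite mevalXU.
Qed.

Lemma Gmx_mul_diag (R : realType) d (r : 'rV[R]_d) (A : 'M[R]_d) (k : 'I_d) :
  (Gmx r *m \col_i A i i) k 0 = mixed_discriminant k 1 (diag_mx r) A.
Proof.
rewrite mixed_discriminant_linear mxE; apply: eq_bigr => j _.
by rewrite !mxE meval_mesym_lift.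
Qed.

(** * Zeros of the ideal and symmetric matrices *)

Lemma real_variety_generated (R : realType) n (I : finType)
    (g : I -> {mpoly R[n]}) v :
  real_variety (ideal_generated g) v <-> forall i, (g i).@[v] = 0.
Proof.
split=> [gv i|gv p [c ->]]; last first.
  by rewrite raddf_sum big1 // => i _; rewrite /= mevalM gv mulr0.
apply: gv; exists (fun k => (k == i)%:R).
rewrite (bigD1 i) //= eqxx mul1r big1 ?addr0 // => k /negPf ->.
by rewrite mul0r.
Qed.

Section SymbolicMatrix.
Variables (R : realType) (d : nat).
Implicit Types (y : 'cV[R]_d) (v : 'I_#|{: upper d}| -> R).

Lemma tr_symbolic_sym y : (symbolic_sym y)^T = symbolic_sym y.
Proof.
apply/matrixP=> i j; rewrite !mxE.
case: (ltngtP i j) => [lt|gt|/ord_inj -> //].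
  by case: insubP => //=; rewrite lt.
by case: insubP => //=; rewrite gt.
Qed.

Lemma symbolic_sym_diag y i : symbolic_sym y i i = (y i 0)%:MP.
Proof. by rewrite mxE ltnn insubF //= ltnn. Qed.

Lemma symbolic_sym_realizes (A : 'M[R]_d) : A^T = A ->
  exists v, map_mx (meval v) (symbolic_sym (\col_i A i i)) = A.
Proof.
move=> symA; exists (fun k => A (val (enum_val k)).1 (val (enum_val k)).2).
apply/matrixP=> i j; rewrite 2!mxE.
case: insubP => [p _ vp|].
  rewrite mevalXU enum_rankK vp.
  by case: (i < j)%N => //=; rewrite -[in RHS]symA mxE.
case: (ltngtP i j) => /= [->//|->//|/ord_inj -> _].
by rewrite mevalC mxE.
Qed.

Lemma meval_generator (f : {mpoly R[2]}) (r : 'rV[R]_d) y v (a : monomial_range d) :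
  (generator f r y a).@[v] =
  mixed_discriminant (val a).1 (val a).2 (diag_mx r)
     (map_mx (meval v) (symbolic_sym y)) - f@_(mnm2 (val a).1 (val a).2).
Proof.
rewrite /generator mevalB mevalC -map_mixed_discriminant; congr (_ - _).
congr mixed_discriminant; apply/matrixP=> i j.
by rewrite !mxE /= mevalC.
Qed.

End SymbolicMatrix.

(** * The characterization of determinantal polynomials *)

Lemma mixed_discriminant_gt (K : comNzRingType) d a b (D A : 'M[K]_d) :
  (d < a + b)%N -> mixed_discriminant a b D A = 0.
Proof.
move=> ltd; rewrite /mixed_discriminant big_pred0 // => S.
apply/eqP=> cS; have: (#|S| <= d)%N by rewrite -[leqRHS]card_ord max_card.
by rewrite cS leqNgt ltd.
Qed.

Lemma mpoly2P (R : realType) (f g : {mpoly R[2]}) :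
  (forall a b, f@_(mnm2 a b) = g@_(mnm2 a b)) -> f = g.
Proof.
move=> fg; apply/mpolyP=> m.
by have /eqP -> : m == mnm2 (m 0) (m 1) by rewrite mnm2_eq !eqxx.
Qed.

Theorem theorem4p1 (R : realType) (d : nat) (f : {mpoly R[2]}) (r : 'rV[R]_d)
    (* total degree d: [msize] is one more than the degree *)
    (hdeg : msize f = d.+1)
    (hf00 : f.@[fun _ => 0] = 1)
    (hreal : all_roots_real (restr_x1 f))
    (hD1 : restr_x1 f = det_pencil1 (diag_mx r)) :
  determinantal (diag_mx r) f <->
  exists y : 'cV[R]_d,
    Gmx r *m y = zvec d f /\
    exists v : 'I_#|{: upper d}| -> R, real_variety (idealI f r y) v.
Proof.
split=> [[A [symA fA]]|[y [Gy [v /real_variety_generated gv]]]].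
  have [v vA] := symbolic_sym_realizes symA.
  exists (\col_i A i i); split.
    by apply/colP=> k; rewrite Gmx_mul_diag mxE fA mcoeff_det_pencil2.
  exists v; apply/real_variety_generated => a.
  by rewrite meval_generator vA fA mcoeff_det_pencil2 subrr.
set A := map_mx (meval v) (symbolic_sym y).
exists A; split; first by rewrite /A map_trmx tr_symbolic_sym.
have yA : y = \col_i A i i.
  by apply/colP=> i; rewrite 2!mxE symbolic_sym_diag mevalC.
apply: mpoly2P => a b; rewrite mcoeff_det_pencil2.
case: (ltnP d (a + b)) => [gtd|led].
  rewrite mixed_discriminant_gt // memN_msupp_eq0 // msize_mdeg_ge // hdeg.
  by rewrite mdegE big_ord_recl big_ord1 !mnm_tnth.
case: b led => [|[|b]] led.
- by rewrite -mcoeff_det_pencil2 -!coef_restr_x1 restr_x1_det_pencil2 hD1.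
- rewrite addn1 in led; move/colP/(_ (Ordinal led)): Gy.
  by rewrite yA Gmx_mul_diag mxE.
have lta : (a < d.+1)%N by rewrite ltnS (leq_trans (leq_addr _ _) led).
have leb : (b.+2 <= d)%N := leq_trans (leq_addl _ _) led.
have ab : [&& a <= d - 2, 2 <= b.+2 <= d & a + b.+2 <= d]%N.
  rewrite led leb !andbT leq_subRL; last exact: leq_trans leb.
  by rewrite addnC; apply: leq_trans led; rewrite leq_add2l.
have := gv (exist _ (Ordinal lta, Ordinal (leb : b.+2 < d.+1)%N) ab : monomial_range d).
by rewrite meval_generator /= => /eqP; rewrite subr_eq0 => /eqP.
Qed.
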